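(* For $\mathrm{CSP}_p$ processes $\{x_{ij}\}_{i\in I,j\in J}$, pairwise distinct actions $\{a_i\}_{i\in I}\subseteq\mathcal{A}$ and probabilities $\pi_j\in(0,1]$ ($j\in J$) with $\sum_{j\in J}\pi_j=1$, it holds that $$\sum_{i\in I}a_i.\bigoplus_{j\in J}\pi_jx_{ij}\ \approx_{\mathcal{O}}\ \bigoplus_{j\in J}\pi_j\sum_{i\in I}a_i.x_{ij}.$$
   Context: Fix a finite set of actions $\mathcal{A}$. A probabilistic transition system (PTS) is a tuple $(S_n,S_p,\rightarrow,\dashrightarrow)$ where $S_n,S_p$ are finite disjoint sets of nondeterministic and probabilistic states; $\rightarrow\ \subseteq S_n\times\mathcal{A}\times(S_n\cup S_p)$ is an action transition relation such that $(s,a,t),(s,a,t')\in\rightarrow$ implies $t=t'$; and $\dashrightarrow\ \subseteq S_p\times(0,1]\times S_n$ is a probabilistic transition relation with $\sum_{(s,\pi,t)\in\dashrightarrow}\pi=1$ for every $s\in S_p$. A state with no outgoing transitions belongs to $S_n$. Write $s\xrightarrow{a}t$ and $s\overset{\pi}{\dashrightarrow}t$. A process is a state together with all states reachable from it and the transitions between them. For $s\in S_n$, its menu is $I(s)=\{a\in\mathcal{A}: s\xrightarrow{a}t \text{ for some } t\}$. Given a process $s$, a set $M\subseteq\mathcal{A}$ and $a\in M$ such that $I(s)=M$ if $s\in S_n$, or otherwise there is $s\overset{}{\dashrightarrow}s'$ with $I(s')=M$, the process $s_{(M,a)}$ is defined as follows: if $s\in S_n$, its root is the state $s'$ with $s\xrightarrow{a}s'$;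 if $s\in S_p$, a new root state is created; let $\pi=\sum\{\pi_i : s\overset{\pi_i}{\dashrightarrow}s_i,\ I(s_i)=M\}$; for every $s_i'$ with $s\overset{\pi_i}{\dashrightarrow}s_i\xrightarrow{a}s_i'$ and $I(s_i)=M$: if $s_i'$ has no probabilistic transitions, add an edge from the new root to $s_i'$ with probability $\pi_i/\pi$; and for every $s_i'\overset{\rho}{\dashrightarrow}s_i''$, add an edge from the new root to $s_i''$ with probability $\pi_i\rho/\pi$. A ready trace of length $n$ is a sequence $(M_1,a_1,M_2,\dots,M_{n-1},a_{n-1},M_n)$ with $M_i\subseteq\mathcal{A}$ and $a_i\in M_i$. For a process $s$ and $M\subseteq\mathcal{A}$: $P^1_s(M)=\sum_{s\overset{\pi}{\dashrightarrow}s'}\pi\cdot P^1_{s'}(M)$ if $s\in S_p$; $P^1_s(M)=1$ if $s\in S_n$ and $I(s)=M$; $P^1_s(M)=0$ otherwise. For $n>1$: if $P^1_s(M_1)>0$ then $P^2_s(M_2\mid M_1,a_1)=P^1_{s_{(M_1,a_1)}}(M_2)$ and, for $n>2$, $P^n_s(M_n\mid M_1,a_1,\dots,M_{n-1},a_{n-1})=P^{n-1}_{s_{(M_1,a_1)}}(M_n\mid M_2,a_2,\dots,M_{n-1},a_{n-1})$; if $P^1_s(M_1)=0$ these are undefined. Two processes $s,\bar s$ are probabilistically ready trace equivalent, $s\approx_{\mathcal{O}}\bar s$, iff $P^1_s(M)=P^1_{\bar s}(M)$ for all $M\subseteq\mathcal{A}$, and for every $n>1$ and every ready trace, $P^n_s(M_n\mid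 M_1,a_1,\dots,a_{n-1})$ is defined iff $P^n_{\bar s}(M_n\mid M_1,a_1,\dots,a_{n-1})$ is defined, and then they are equal. $\mathrm{CSP}_p$ processes are generated by $P ::= \delta \mid \sum_{i\in I}a_i.P_i \mid \bigoplus_{i\in I}\pi_iP_i \mid \Theta P \mid P\parallel P \mid P\parallel_L P$, where $\{a_i\}_{i\in I}\subseteq\mathcal{A}$ are pairwise distinct, $\pi_i\in(0,1]$ with $\sum_i\pi_i=1$, and in $P\parallel_L P$ the set $L$ is the set of actions appearing in both operands. $\delta$ has no transitions; $a.p$ is a one-summand external choice. The semantics of the relevant operators is given by the rules (where ''$p\not\dashrightarrow$'' means $p$ has no probabilistic transition): $\sum_{i}a_i.p_i\xrightarrow{a_i}p_i$; if $p_k\not\dashrightarrow$ then $\bigoplus_i\pi_ip_i\overset{\pi_k}{\dashrightarrow}p_k$; if $p_k\overset{\rho_k}{\dashrightarrow}p_k'$ then $\bigoplus_i\pi_ip_i\overset{\pi_k\rho_k}{\dashrightarrow}p_k'$ (and analogous rules for $\Theta,\parallel,\parallel_L$). *)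

(* Defs.v *)
From Stdlib Require List.
From HB Require Import structures.
From mathcomp Require Import all_boot all_order all_algebra.
From mathcomp Require cardinality.
From mathcomp Require Import reals.

Set Implicit Arguments.
Unset Strict Implicit.
Unset Printing Implicit Defensive.

Import Order.TTheory GRing.Theory Num.Theory.
Local Open Scope ring_scope.

(** * Probabilistic transition systems *)

(* The action relation is deterministic, hence a partial function.
   The probabilistic transitions of a state form a finite MULTISET of pairs
   (probability, target), represented by a list whose order is never used:
   with plain sets, two summands of a probabilistic choice with the same
   weight and the same target would be identified, and the weights would no
   longer sum to 1. *)
Record pts (R : realType) (A : finType) (S : Type) := Pts {
  act : S -> A -> option S;
  prob : S -> seq (R * S)
}.

(* Membership in S_p: the weights leaving a state of S_p sum to 1, so such a
   state has a probabilistic transition; every other state is in S_n. *)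
Definition probabilistic (R : realType) (A : finType) (S : Type)
    (T : pts R A S) (s : S) : bool := ~~ nilp (prob T s).

Definition step (R : realType) (A : finType) (S : Type)
    (T : pts R A S) (s t : S) : Prop :=
  (exists a, act T s a = Some t) \/ (exists p, List.In (p, t) (prob T s)).

Inductive reachable (R : realType) (A : finType) (S : Type)
    (T : pts R A S) (s : S) : S -> Prop :=
| reachable_refl : reachable T s s
| reachable_step t u : reachable T s t -> step T t u -> reachable T s u.

(* Finiteness is required of each process (a state with everything reachable
   from it), so that the set of all process terms may be taken as the set of
   states. *)
Record is_pts (R : realType) (A : finType) (S : Type) (T : pts R A S) : Prop :=
  IsPts {
  pts_disjoint : forall s a, probabilistic T s -> act T s a = None;
  pts_prob : forall s,
    all (fun e => (0 < e.1 <= 1) && ~~ probabilistic T e.2) (prob T s);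
  pts_sum1 : forall s, probabilistic T s -> \sum_(e <- prob T s) e.1 = 1;
  pts_finite : forall s, cardinality.finite_set (reachable T s)
}.

Record process (R : realType) (A : finType) := Process {
  pstate : Type;
  psys : pts R A pstate;
  root : pstate
}.

Definition menu (R : realType) (A : finType) (S : Type)
    (T : pts R A S) (s : S) : {set A} := [set a | act T s a].

(** * The process s_(M,a) *)

Definition new_edges (R : realType) (A : finType) (S : Type)
    (T : pts R A S) (s : S) (M : {set A}) (a : A) : seq (R * S) :=
  let tot := \sum_(e <- prob T s | menu T e.2 == M) e.1 in
  flatten [seq (if act T e.2 a is Some s' then
                  if probabilistic T s'
                  then [seq (e.1 * f.1 / tot, f.2) | f <- prob T s']
                  else [:: (e.1 / tot, s')]
                else [::])
          | e <- prob T s & menu T e.2 == M].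

(* [None] is the new root. *)
Definition add_root (R : realType) (A : finType) (S : Type)
    (T : pts R A S) (edges : seq (R * S)) : pts R A (option S) :=
  let inj := map (fun e : R * S => (e.1, Some e.2)) in
  Pts (fun os a => if os is Some s then omap Some (act T s a) else None)
      (fun os => if os is Some s then inj (prob T s) else inj edges).

(* Only meaningful when a \in M and M is the menu of the root (root in S_n)
   or of one of its probabilistic successors (root in S_p); this is the only
   case in which [ready_prob] uses it. *)
Definition after (R : realType) (A : finType)
    (p : process R A) (M : {set A}) (a : A) : option (process R A) :=
  let T := psys p in
  if probabilistic T (root p)
  then Some (Process (add_root T (new_edges T (root p) M a)) None)
  else omap (fun s' => Process T s') (act T (root p) a).

(** * Probabilistic ready trace equivalence *)

(* Probabilistic transitions lead to S_n, so the recursion in the definition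
   of P^1 stops after one step. *)
Definition ready_prob1 (R : realType) (A : finType)
    (p : process R A) (M : {set A}) : R :=
  let T := psys p in
  if probabilistic T (root p)
  then \sum_(e <- prob T (root p)) e.1 * (menu T e.2 == M)%:R
  else (menu T (root p) == M)%:R.

(* P^n_p(M | tr), where tr = [:: (M_1, a_1); ...; (M_(n-1), a_(n-1))];
   [None] means undefined. *)
Fixpoint ready_prob (R : realType) (A : finType)
    (p : process R A) (tr : seq ({set A} * A)) (M : {set A}) : option R :=
  match tr with
  | [::] => Some (ready_prob1 p M)
  | (M1, a1) :: tr' =>
      if 0 < ready_prob1 p M1
      then obind (fun q => ready_prob q tr' M) (after p M1 a1)
      else None
  end.

(* Equality in [option R]: one side is defined iff the other one is, and then
   they are equal. The empty [tr] is the clause on P^1. *)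
Definition ready_trace_equiv (R : realType) (A : finType)
    (p q : process R A) : Prop :=
  forall (tr : seq ({set A} * A)) (M : {set A}),
    all (fun Ma : {set A} * A => Ma.2 \in Ma.1) tr ->
    ready_prob p tr M = ready_prob q tr M.

(** * CSP_p *)

Definition distribution (R : realType) (n : nat) (pi : 'I_n -> R) : Prop :=
  (forall i, 0 < pi i <= 1) /\ \sum_(i < n) pi i = 1.

(* [SyncPar] carries its set L explicitly, because L stays fixed while the
   operands evolve, so that derivatives of a process need not satisfy the
   constraint on L imposed by [csp_process]. *)
Inductive csp (R : realType) (A : finType) : Type :=
| Delta
| ExtChoice (n : nat) (a : 'I_n -> A) (_ : injective a) (P : 'I_n -> csp R A)
| ProbChoice (n : nat) (pi : 'I_n -> R) (_ : distribution pi)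
    (P : 'I_n -> csp R A)
| Theta (P : csp R A)
| Par (P Q : csp R A)
| SyncPar (L : {set A}) (P Q : csp R A).

Arguments Delta {R A}.
Arguments ExtChoice {R A n a} _ _.
Arguments ProbChoice {R A n pi} _ _.

Fixpoint actions (R : realType) (A : finType) (P : csp R A) : {set A} :=
  match P with
  | Delta => set0
  | ExtChoice n a _ Q => [set a i | i : 'I_n] :|: \bigcup_(i < n) actions (Q i)
  | ProbChoice n _ _ Q => \bigcup_(i < n) actions (Q i)
  | Theta Q => actions Q
  | Par Q1 Q2 => actions Q1 :|: actions Q2
  | SyncPar _ Q1 Q2 => actions Q1 :|: actions Q2
  end.

Fixpoint csp_process (R : realType) (A : finType) (P : csp R A) : Prop :=
  match P with
  | Delta => True
  | ExtChoice n _ _ Q => forall i, csp_process (Q i)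
  | ProbChoice n _ _ Q => forall i, csp_process (Q i)
  | Theta Q => csp_process Q
  | Par Q1 Q2 => csp_process Q1 /\ csp_process Q2
  | SyncPar L Q1 Q2 =>
      [/\ L = actions Q1 :&: actions Q2, csp_process Q1 & csp_process Q2]
  end.

(* The operational rules of delta and of the two choices. The behaviour of
   Theta, || and ||_L is left open: any transition system on terms that
   obeys these rules is an admissible semantics. *)
Record csp_semantics (R : realType) (A : finType) (T : pts R A (csp R A)) :
    Prop := CspSemantics {
  delta_act : forall b, act T Delta b = None;
  delta_prob : prob T Delta = [::];
  ext_act : forall n (a : 'I_n -> A) (a_inj : injective a) P b Q,
    act T (ExtChoice a_inj P) b = Some Q <-> exists2 k, a k = b & P k = Q;
  ext_prob : forall n (a : 'I_n -> A) (a_inj : injective a) P,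
    prob T (ExtChoice a_inj P) = [::];
  prob_act : forall n (pi : 'I_n -> R) (pi_dist : distribution pi) P b,
    act T (ProbChoice pi_dist P) b = None;
  prob_prob : forall n (pi : 'I_n -> R) (pi_dist : distribution pi) P,
    prob T (ProbChoice pi_dist P) =
      flatten [seq (if probabilistic T (P k)
                    then [seq (pi k * e.1, e.2) | e <- prob T (P k)]
                    else [:: (pi k, P k)])
              | k <- enum 'I_n]
}.

(* Main.v *)
(* After performing a_i, the left-hand process is in the state
   ⊕_j pi_j x_ij, whereas the right-hand one is in the fresh root created by
   s_(M,a). Every state ∑_i a_i.x_ij has the same menu, so the normalising
   factor of that root is 1 and its edges are exactly those of ⊕_j pi_j x_ij.
   Collapsing the fresh root onto this state is a functional morphism of
   transition systems, and such morphisms preserve ready trace probabilities. *)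

Require Import Defs.
From mathcomp Require Import all_boot all_order all_algebra.
From mathcomp Require Import reals.

Set Implicit Arguments.
Unset Strict Implicit.
Unset Printing Implicit Defensive.

Import Order.TTheory GRing.Theory Num.Theory.
Local Open Scope ring_scope.

Section Morphism.

Variables (R : realType) (A : finType).

Definition map_edges (S1 S2 : Type) (h : S1 -> S2) (es : seq (R * S1)) :
  seq (R * S2) := [seq (e.1, h e.2) | e <- es].

(** A functional bisimulation in a strict form: edges correspond one by one as lists, and edges that
    [h] sends to the same target are not merged, so sums over edges transfer by mere reindexing. *)
Record pts_morphism (S1 S2 : Type) (T1 : pts R A S1) (T2 : pts R A S2)
    (h : S1 -> S2) : Prop := PtsMorphism {
  morph_act : forall s b, act T2 (h s) b = omap h (act T1 s b);
  morph_prob : forall s, prob T2 (h s) = map_edges h (prob T1 s)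
}.

Section Preservation.

Variables (S1 S2 : Type) (T1 : pts R A S1) (T2 : pts R A S2) (h : S1 -> S2).
Hypothesis hM : pts_morphism T1 T2 h.

Lemma morph_probabilistic s : probabilistic T2 (h s) = probabilistic T1 s.
Proof. by rewrite /probabilistic (morph_prob hM) /nilp size_map. Qed.

Lemma morph_menu s : menu T2 (h s) = menu T1 s.
Proof. by apply/setP => b; rewrite !inE (morph_act hM); case: act. Qed.

Lemma morph_ready_prob1 s M :
  ready_prob1 (Process T1 s) M = ready_prob1 (Process T2 (h s)) M.
Proof.
rewrite /ready_prob1 /= morph_probabilistic morph_menu (morph_prob hM) big_map.
by under [in RHS]eq_bigr => e _ do rewrite /= morph_menu.
Qed.

Lemma morph_new_edges s M a :
  new_edges T2 (h s) M a = map_edges h (new_edges T1 s M a).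
Proof.
rewrite /new_edges (morph_prob hM) /map_edges filter_map big_map map_flatten.
rewrite -!map_comp.
(* Since [h] preserves menus, both sides select the same edges and share one normalising factor. *)
under eq_bigl => e do rewrite /= morph_menu.
set tot := \sum_(e <- _ | _) _.
rewrite (eq_filter (a2 := fun e => menu T1 e.2 == M)); last first.
  by move=> e /=; rewrite morph_menu.
congr flatten; apply: eq_map => e /=.
rewrite (morph_act hM); case: act => [t|] //=.
rewrite morph_probabilistic (morph_prob hM); case: ifP => //= _.
by rewrite -!map_comp.
Qed.

(** Sending fresh root to fresh root extends [h], which lets a morphism survive the passage to
    [after]. *)
Lemma morph_add_root es :
  pts_morphism (add_root T1 es) (add_root T2 (map_edges h es)) (omap h).
Proof.
split=> [[s|] b|[s|]] //=.
- by rewrite (morph_act hM); case: act.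
- by rewrite (morph_prob hM) /map_edges -!map_comp.
- by rewrite /map_edges -!map_comp.
Qed.

End Preservation.

Lemma morph_ready_prob (S1 S2 : Type) (T1 : pts R A S1) (T2 : pts R A S2)
    (h : S1 -> S2) s tr M : pts_morphism T1 T2 h ->
  ready_prob (Process T1 s) tr M = ready_prob (Process T2 (h s)) tr M.
Proof.
(* The state types and the morphism must vary in the induction: leaving a probabilistic state
   replaces [S1] and [S2] by their option types and [h] by [omap h]. *)
elim: tr S1 S2 T1 T2 h s => [|[M1 a] tr IH] S1 S2 T1 T2 h s hM /=.
  by rewrite (morph_ready_prob1 hM).
rewrite (morph_ready_prob1 hM); case: ifP => // _.
rewrite /after /= (morph_probabilistic hM); case: ifP => _ /=.
  rewrite (morph_new_edges hM).
  exact: (IH _ _ _ _ _ None (morph_add_root hM _)).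
by rewrite (morph_act hM); case: act => //= t; apply: IH.
Qed.

(** The fresh root has no actions, so it can be identified with [s] only if [s] has none either. *)
Lemma collapse_root_morphism (S : Type) (T : pts R A S) (s : S) :
  (forall b, act T s b = None) ->
  pts_morphism (add_root T (prob T s)) T (odflt s).
Proof.
move=> s_act; have id_map es : map_edges (odflt s)
    [seq (e.1, Some e.2) | e <- es] = es.
  by rewrite /map_edges -map_comp -[RHS]map_id; apply: eq_map => -[].
by split=> [[t|] b|[t|]] //=; case: act.
Qed.

End Morphism.

Section ExternalChoice.

Variables (R : realType) (A : finType) (T : pts R A (csp R A)).
Hypothesis T_csp : csp_semantics T.
Variables (m : nat) (a : 'I_m -> A).
Hypothesis a_inj : injective a.

Lemma act_ExtChoice (P : 'I_m -> csp R A) i :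
  act T (ExtChoice a_inj P) (a i) = Some (P i).
Proof. by apply/(ext_act T_csp); exists i. Qed.

Lemma probabilistic_ExtChoice (P : 'I_m -> csp R A) :
  probabilistic T (ExtChoice a_inj P) = false.
Proof. by rewrite /probabilistic (ext_prob T_csp). Qed.

Lemma menu_ExtChoice (P : 'I_m -> csp R A) :
  menu T (ExtChoice a_inj P) = [set a i | i : 'I_m].
Proof.
apply/setP => b; rewrite inE; apply/idP/imsetP => [|[i _ ->]].
  case E: act => [Q|] // _.
  by have [k <- _] := (ext_act T_csp _ _ _ _).1 E; exists k.
by rewrite act_ExtChoice.
Qed.

Variables (n : nat) (pi : 'I_n -> R).
Hypothesis pi_dist : distribution pi.

Lemma prob_ProbChoice_ExtChoice (x : 'I_n -> 'I_m -> csp R A) :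
  prob T (ProbChoice pi_dist (fun j => ExtChoice a_inj (x j))) =
    [seq (pi j, ExtChoice a_inj (x j)) | j <- enum 'I_n].
Proof.
rewrite (prob_prob T_csp) -[RHS]flatten_seq1 -map_comp; congr flatten.
by apply: eq_map => j; rewrite probabilistic_ExtChoice.
Qed.

Lemma probabilistic_ProbChoice (P : 'I_n -> csp R A) :
  probabilistic T (ProbChoice pi_dist P).
Proof.
rewrite /probabilistic (prob_prob T_csp).
(* An empty family would have total weight 0 instead of 1; otherwise the first summand already
   yields an edge. *)
case: n pi pi_dist P => [p [_]|k p p_dist P].
  by rewrite big_ord0 => /esym/eqP; rewrite oner_eq0.
rewrite enum_ordSl /=; case: ifP => // /negbTE.
by rewrite /nilp /= size_cat size_map addn_eq0 => ->.
Qed.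

Lemma new_edges_ProbChoice_ExtChoice (x : 'I_m -> 'I_n -> csp R A) i :
  new_edges T (ProbChoice pi_dist (fun j => ExtChoice a_inj (fun i => x i j)))
    [set a i | i : 'I_m] (a i) = prob T (ProbChoice pi_dist (x i)).
Proof.
rewrite /new_edges prob_ProbChoice_ExtChoice big_map filter_map.
under eq_bigl => j do rewrite /= menu_ExtChoice eqxx.
rewrite big_enum /= pi_dist.2 (prob_prob T_csp) -map_comp.
rewrite (eq_filter (a2 := predT)); last first.
  by move=> j /=; rewrite menu_ExtChoice eqxx.
rewrite filter_predT; congr flatten; apply: eq_map => j /=.
(* With the divisor gone, the case split in [new_edges] on whether [x i j] is probabilistic is the
   one in the rule for probabilistic choice. *)
rewrite act_ExtChoice divr1; case: ifP => // _.
by apply: eq_map => e; rewrite divr1.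
Qed.

End ExternalChoice.

Theorem theorem2 (R : realType) (A : finType)
    (T : pts R A (csp R A)) (T_pts : is_pts T) (T_csp : csp_semantics T)
    (m n : nat)
    (a : 'I_m -> A) (a_inj : injective a)
    (pi : 'I_n -> R) (pi_dist : distribution pi)
    (x : 'I_m -> 'I_n -> csp R A) (x_proc : forall i j, csp_process (x i j)) :
  ready_trace_equiv
    (Process T (ExtChoice a_inj (fun i => ProbChoice pi_dist (fun j => x i j))))
    (Process T (ProbChoice pi_dist (fun j => ExtChoice a_inj (fun i => x i j)))).
Proof.
set p := Process T (ExtChoice _ _); set q := Process T (ProbChoice _ _).
have p1E M : ready_prob1 p M = ([set a i | i : 'I_m] == M)%:R.
  by rewrite /ready_prob1 probabilistic_ExtChoice // menu_ExtChoice.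
have q1E M : ready_prob1 q M = ([set a i | i : 'I_m] == M)%:R.
  rewrite /ready_prob1 probabilistic_ProbChoice // prob_ProbChoice_ExtChoice //.
  rewrite big_map big_enum /=.
  (* The indicator does not depend on [j], so it factors out of a sum of weights equal to 1. *)
  under eq_bigr => j _ do rewrite menu_ExtChoice //.
  by rewrite -mulr_suml pi_dist.2 mul1r.
case=> [|[M1 b] tr] M /=; first by rewrite p1E q1E.
(* Both sides are undefined unless [M1] is the common menu; then [b], lying in [M1], is some
   [a i]. *)
rewrite p1E q1E ltr0n lt0b; case: eqP => // <- /andP[/imsetP[i _ ->] _].
rewrite /after probabilistic_ExtChoice // probabilistic_ProbChoice //=.
rewrite act_ExtChoice // new_edges_ProbChoice_ExtChoice //=.
(* The collapse maps the system with the fresh root to [T], so that side must come first;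
   [odflt s None] is [s]. *)
set s := ProbChoice _ _; symmetry.
apply: (@morph_ready_prob _ _ _ _ _ _ (odflt s) None).
by apply: collapse_root_morphism; apply: prob_act.
Qed.
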